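(* Let $d=k=2$, let $\alpha=\infty$, and let $\varepsilon>0$ (with $\varepsilon\le 1$). Let $\mathcal E_\infty$ be the set of eventually always reinforced edges of the $\alpha=\infty$ reinforced $2$-out process on $\mathbb Z^2$, let $\mathcal E_{\varepsilon,\mathrm{spr}}$ be an independent Bernoulli bond percolation process on $\mathbb Z^2$ with parameter $\varepsilon$, and put $\mathcal E_{\infty,\varepsilon}:=\mathcal E_\infty\cup\mathcal E_{\varepsilon,\mathrm{spr}}$. Then $$\mathbb P(\mathcal E_{\infty,\varepsilon}\text{ percolates})=1\quad\text{or}\quad \mathbb P(\mathcal E_{\infty,\varepsilon}\text{ percolates dually})=1.$$
   Context: Reinforced $k$-out process with $\alpha=\infty$ on $\mathbb Z^d$ (here $d=k=2$). Let $E$ be the set of nearest-neighbour edges of $\mathbb Z^d$. Each edge $e\in E$ carries a weight $W_e(t)$, $t=0,1,2,\dots$, with $W_e(0)=1$. In each round $t\ge1$, simultaneously for all sites $z\in\mathbb Z^d$, the $2d$ edges incident to $z$ are ordered decreasingly by their current weights $W_e(t-1)$, ties being broken uniformly at random, independently over sites and rounds; $z$ selects the first $k$ edges in this order. Then $W_e(t)-W_e(t-1)\in\{0,1,2\}$ is the number of endpoints of $e$ that selected $e$ in round $t$. Define $$\mathcal E_\infty:=\{e\in E:\ \liminf_{t\to\infty}(W_e(t)-W_e(t-1))\ge1\}.$$ Percolation. Two edges of $\mathbb Z^2$ are adjacent if they share an endpoint. Two edges of $\mathbb Z^2$ are dually adjacent if there is $z\in\mathbb Z^2$ such that the boundary $\partial(z+[0,1]^2)$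 of a unit square contains both edges. A set of edges $\mathcal E\subseteq E$ percolates if there is an infinite sequence of distinct edges $(e_0,e_1,e_2,\dots)$ in $\mathcal E$ such that $e_{i-1}$ and $e_i$ are adjacent for all $i\ge1$; it percolates dually if there is an infinite sequence of distinct edges in $\mathcal E$ such that $e_{i-1}$ and $e_i$ are dually adjacent for all $i\ge1$. Sprinkling. $\mathcal E_{\varepsilon,\mathrm{spr}}$ contains each edge of $E$ independently with probability $\varepsilon$, and is independent of the weight process. *)

(* Defs.v *)
From HB Require Import structures.
From mathcomp Require Import all_boot all_order all_algebra perm.
From mathcomp Require Import all_classical all_reals all_analysis.
Set Implicit Arguments.
Unset Strict Implicit.
Unset Printing Implicit Defensive.
Import Order.TTheory GRing.Theory Num.Theory.
Import numFieldNormedType.Exports.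
Local Open Scope classical_set_scope.
Local Open Scope ring_scope.

Definition site : Type := (int * int)%type.

Definition unit_vec (b : bool) : site := if b then (0, 1) else (1, 0).

(* The pair (z, b) encodes the unoriented edge joining z and z + unit_vec b;
   every nearest-neighbour edge has exactly one such code. *)
Definition edge : Type := (site * bool)%type.

Definition endpoints (e : edge) : seq site := [:: e.1; e.1 + unit_vec e.2].

Definition star (z : site) (i : 'I_4) : edge :=
  tnth [tuple (z, false); (z, true); (z - unit_vec false, false);
              (z - unit_vec true, true)] i.

(* The four edges in the boundary of z + [0,1]^2. *)
Definition square (z : site) : seq edge :=
  [:: (z, false); (z, true); (z + unit_vec true, false);
      (z + unit_vec false, true)].

Definition adjacent (e f : edge) : Prop :=
  exists z : site, z \in endpoints e /\ z \in endpoints f.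

Definition dually_adjacent (e f : edge) : Prop :=
  exists z : site, e \in square z /\ f \in square z.

Definition has_infinite_path (adj : edge -> edge -> Prop) (A : set edge) : Prop :=
  exists u : nat -> edge,
    [/\ injective u, forall n, A (u n) & forall n, adj (u n) (u n.+1)].

Definition percolates : set edge -> Prop := has_infinite_path adjacent.

Definition percolates_dually : set edge -> Prop :=
  has_infinite_path dually_adjacent.

(* Total order on the edges at z: decreasing weight w, ties broken by
   increasing value of s. *)
Definition precedes (w : edge -> nat) (s : 'S_4) (z : site) : rel 'I_4 :=
  fun i j => (w (star z j) < w (star z i))%N
             || (w (star z i) == w (star z j)) && (s i <= s j)%N.

Definition selection (k : nat) (w : edge -> nat) (s : 'S_4) (z : site) :
    seq edge :=
  map (star z) (take k (sort (precedes w s z) (enum 'I_4))).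

(* [s t z] breaks the ties at z in round t, t >= 1; [s 0 z] plays no role. *)
Fixpoint weight (k : nat) (s : nat -> site -> 'S_4) (t : nat) (e : edge) : nat :=
  if t is t'.+1 then
    (weight k s t' e +
     count (fun z => e \in selection k (weight k s t') (s t z) z) (endpoints e))%N
  else 1%N.

Definition eventually_reinforced (R : realType) (w : nat -> edge -> nat) :
    set edge :=
  [set e | (1 <= limn_einf (fun t => ((w t.+1 e)%:R - (w t e)%:R : R)%:E))%E].

Section Discrete.
Context (d : measure_display) (T : measurableType d) (R : realType).
Variable P : probability T R.

(* The countable set V of values carries the discrete sigma-algebra. *)
Definition discrete_rv (V : countType) (X : T -> V) : Prop :=
  forall v, measurable (X @^-1` [set v]).

Definition mutually_independent (I : choiceType) (V : countType)
    (X : I -> T -> V) : Prop :=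
  forall (J : seq I) (B : I -> set V), uniq J ->
    P (\bigcap_(i in [set` J]) (X i @^-1` B i)) =
    (\prod_(i <- J) P (X i @^-1` B i))%E.

Definition generated_by (I : Type) (V : countType) (X : I -> T -> V) :
    set (set T) :=
  <<s [set A | exists i v, A = X i @^-1` [set v]] >>.

Definition independent_families (I J : Type) (V W : countType)
    (X : I -> T -> V) (Y : J -> T -> W) : Prop :=
  forall A B : set T, generated_by X A -> generated_by Y B ->
    P (A `&` B) = (P A * P B)%E.

Definition uniform_tie_breaking (sigma : nat -> site -> T -> 'S_4) : Prop :=
  [/\ forall t z, discrete_rv (sigma t z),
      forall t z (p : 'S_4),
        P (sigma t z @^-1` [set p]) = ((4`!%:R)^-1 : R)%:E &
      mutually_independent (fun tz : nat * site => sigma tz.1 tz.2)].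

Definition bernoulli_percolation (eps : R) (spr : edge -> T -> bool) : Prop :=
  [/\ forall e, discrete_rv (spr e),
      forall e, P (spr e @^-1` [set true]) = eps%:E &
      mutually_independent spr].

End Discrete.

Definition weight_process (T : Type) (k : nat)
    (sigma : nat -> site -> T -> 'S_4) : nat * edge -> T -> nat :=
  fun te x => weight k (fun t z => sigma t z x) te.1 te.2.

Definition reinforced_edges (R : realType) (T : Type) (k : nat)
    (sigma : nat -> site -> T -> 'S_4) (x : T) : set edge :=
  eventually_reinforced R (fun t e => weight_process k sigma (t, e) x).

Definition sprinkled_edges (T : Type) (spr : edge -> T -> bool) (x : T) :
    set edge := [set e | spr e x].

(* Main.v *)
Require Import Defs.
From mathcomp Require Import all_boot all_order all_algebra perm.
From mathcomp Require Import all_classical all_reals all_analysis.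
From mathcomp Require Import zify lra.
Set Implicit Arguments.
Unset Strict Implicit.
Unset Printing Implicit Defensive.
Import Order.TTheory GRing.Theory Num.Theory.
Local Open Scope classical_set_scope.
Local Open Scope ring_scope.

(* It is always the dual percolation that has probability one.

   Once the two heaviest edges at a site are strictly heavier than the other
   two, the site selects them forever.  In every round, given all the other tie
   breaks, the tie break that prefers the edges selected from their other
   endpoint produces such a gap, so almost surely it appears, and the edges
   outside E_infinity form a graph of maximal degree 2.

   If the sprinkled set A does not percolate dually, then every set of faces
   joined by crossing edges of A is finite, hence enclosed by a circuit of edges
   outside A.  Forcing the faces (0,0), ..., (n,0) into one such set yields some
   m >= n and a self-avoiding walk of m + 1 edges outside A that starts at
   (m + 1, 0).  In a graph of maximal degree 2 a self-avoiding walk is determined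
   by its first step, so such a walk survives the sprinkling with probability at
   most 4 (1 - eps) ^ (m + 1), and Borel-Cantelli excludes that this happens for
   infinitely many m. *)

(** * Settled sites *)

Lemma addsE (x y a b : int) : ((x, y) : site) + (a, b) = (x + a, y + b).
Proof. by []. Qed.

Lemma oppsE (a b : int) : - ((a, b) : site) = (- a, - b).
Proof. by []. Qed.

Definition neighbour (z : site) (i : 'I_4) : site :=
  tnth [tuple z + unit_vec false; z + unit_vec true;
              z - unit_vec false; z - unit_vec true] i.

Lemma ord4P (Q : 'I_4 -> Prop) :
  Q (inord 0) -> Q (inord 1) -> Q (inord 2) -> Q (inord 3) -> forall i, Q i.
Proof.
move=> Q0 Q1 Q2 Q3 i; rewrite -(inord_val i).
by case: i => [[|[|[|[|//]]]] Hi].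
Qed.

Lemma starE (z : site) :
  [/\ star z (inord 0) = (z, false), star z (inord 1) = (z, true),
      star z (inord 2) = (z - unit_vec false, false) &
      star z (inord 3) = (z - unit_vec true, true)].
Proof. by split; rewrite /star (tnth_nth (z, false)) /= inordK. Qed.

Lemma neighbourE (z : site) :
  [/\ neighbour z (inord 0) = z + unit_vec false,
      neighbour z (inord 1) = z + unit_vec true,
      neighbour z (inord 2) = z - unit_vec false &
      neighbour z (inord 3) = z - unit_vec true].
Proof. by split; rewrite /neighbour (tnth_nth z) /= inordK. Qed.

Lemma endpoints_star (z : site) (i : 'I_4) :
  perm_eq (endpoints (star z i)) [:: z; neighbour z i].
Proof.
have [s0 s1 s2 s3] := starE z; have [n0 n1 n2 n3] := neighbourE z.
move: i; apply: ord4P; rewrite ?s0 ?s1 ?s2 ?s3 ?n0 ?n1 ?n2 ?n3 /endpoints /= ?subrK //.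
  by rewrite (perm_catC [:: _] [:: _]).
by rewrite (perm_catC [:: _] [:: _]).
Qed.

Lemma star_inj (z : site) : injective (star z).
Proof.
have [s0 s1 s2 s3] := starE z; case: z s0 s1 s2 s3 => x y s0 s1 s2 s3.
apply: ord4P; apply: ord4P; rewrite ?s0 ?s1 ?s2 ?s3 ?oppsE ?addsE //=;
 by case=> *; exfalso; lia.
Qed.

Lemma neighbour_neq (z : site) (i : 'I_4) : neighbour z i != z.
Proof.
have [s0 s1 s2 s3] := neighbourE z; case: z s0 s1 s2 s3 => x y s0 s1 s2 s3.
by move: i; apply: ord4P; rewrite ?s0 ?s1 ?s2 ?s3 ?oppsE ?addsE //=;
 apply/eqP; case=> *; lia.
Qed.

Section Round.
Variables (w : edge -> nat) (s : site -> 'S_4) (z : site).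

Lemma precedes_total (p : 'S_4) : total (precedes w p z).
Proof.
move=> i j; rewrite /precedes.
by case: ltngtP => //= _; exact: leq_total.
Qed.

Lemma precedes_trans (p : 'S_4) : transitive (precedes w p z).
Proof.
move=> j i k; rewrite /precedes => /orP[h1|/andP[/eqP h1 h1']] /orP[h2|/andP[/eqP h2 h2']];
  lia.
Qed.

Definition chosen : {set 'I_4} := [set i | star z i \in selection 2 w (s z) z]%SET.

Lemma mem_chosen i :
  (i \in chosen) = (i \in take 2 (sort (precedes w (s z) z) (enum 'I_4))).
Proof. by rewrite inE /selection mem_map //; exact: star_inj. Qed.

Lemma card_chosen : #|chosen| = 2%N.
Proof.
rewrite (eq_card mem_chosen); set r := sort _ _.
have ur : uniq (take 2 r) by rewrite take_uniq// sort_uniq enum_uniq.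
by rewrite (card_uniqP ur) size_takel// size_sort size_enum_ord.
Qed.

Lemma chosen_precedes i j : i \in chosen -> j \notin chosen ->
  precedes w (s z) z i j.
Proof.
rewrite !mem_chosen; set r := sort _ _ => ir jr.
have : sorted (precedes w (s z) z) r by apply: sort_sorted; exact: precedes_total.
rewrite (sorted_pairwise (@precedes_trans _)) -(cat_take_drop 2 r) pairwise_cat.
case/andP => /allrelP/(_ i j ir) + _; apply.
have : j \in r by rewrite mem_sort mem_enum.
by rewrite -{1}(cat_take_drop 2 r) mem_cat (negPf jr).
Qed.

Lemma chosen_le i j : i \in chosen -> j \notin chosen ->
  (w (star z j) <= w (star z i))%N.
Proof. by move=> /chosen_precedes h /h; rewrite /precedes; lia. Qed.

Lemma chosen_tie i j : i \in chosen -> j \notin chosen ->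
  w (star z j) = w (star z i) -> (s z i < s z j)%N.
Proof.
move=> ic jc; move: (chosen_precedes ic jc); rewrite /precedes => h e.
rewrite ltn_neqAle; apply/andP; split; last lia.
by rewrite val_eqE (inj_eq perm_inj); apply: contraNneq jc => <-.
Qed.

End Round.

Definition next_weight (w : edge -> nat) (s : site -> 'S_4) (e : edge) : nat :=
  (w e + count (fun z => e \in selection 2 w (s z) z) (endpoints e))%N.

Lemma next_weight_star w s z i : next_weight w s (star z i) =
  (w (star z i) + (i \in chosen w s z) +
    (star z i \in selection 2 w (s (neighbour z i)) (neighbour z i)))%N.
Proof.
rewrite /next_weight (seq.permP (endpoints_star z i)) /= addn0.
by rewrite inE addnA.
Qed.

(** A strict gap leaves no role to the tie break at [z]. The boolean form over finite sets makes
    this a function of the four weights at [z], which gives its measurability. *)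
Definition settled (w : edge -> nat) (z : site) : bool :=
  [exists S : {set 'I_4}, (#|S| == 2%N) &&
    [forall i in S, forall j in ~: S, (w (star z j) < w (star z i))%N]].

Lemma settledP w z : reflect (exists2 S : {set 'I_4}, #|S| = 2%N &
    forall i j, i \in S -> j \notin S -> (w (star z j) < w (star z i))%N)
  (settled w z).
Proof.
apply: (iffP existsP) => -[S].
  case/andP => /eqP cS /forall_inP h; exists S => // i j iS jS.
  by apply: (forall_inP (h i iS)); rewrite inE.
move=> cS h; exists S; rewrite cS eqxx /=; apply/forall_inP => i iS.
by apply/forall_inP => j; rewrite inE => jS; exact: h.
Qed.

(** Two distinct sets of two directions each contain an element missing from the other. The gap and
    [chosen_le] would then order the weights of these two edges in opposite ways. *)
Lemma settled_chosen w s z (S : {set 'I_4}) : #|S| = 2%N ->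
  (forall i j, i \in S -> j \notin S -> (w (star z j) < w (star z i))%N) ->
  chosen w s z = S.
Proof.
move=> cS h; apply/eqP; rewrite eq_sym eqEcard cS card_chosen leqnn andbT.
apply/fintype.subsetP => i iS; apply: contraT => ic.
have : ~~ (chosen w s z \subset S).
  apply: contra ic => sub; have /eqP -> // : chosen w s z == S.
  by rewrite eqEcard sub cS card_chosen.
case/fintype.subsetPn => j jc jS.
by have := h _ _ iS jS; rewrite ltnNge (chosen_le jc ic).
Qed.

(** Edges in [S] gain at least 1 from [z], and the others gain at most 1, from their other endpoint,
    so a strict gap persists. *)
Lemma settled_next w s z (S : {set 'I_4}) : #|S| = 2%N ->
  (forall i j, i \in S -> j \notin S -> (w (star z j) < w (star z i))%N) ->
  (forall i j, i \in S -> j \notin S ->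
    (next_weight w s (star z j) < next_weight w s (star z i))%N).
Proof.
move=> cS h i j iS jS; rewrite !next_weight_star (settled_chosen s cS h) iS (negPf jS).
have := h i j iS jS; lia.
Qed.

(** Since a neighbour differs from [z], this set does not depend on the tie break [s z]; the
    independence argument for settling rests on this. *)
Definition chosen_by_others (w : edge -> nat) (s : site -> 'S_4) (z : site) :
    {set 'I_4} :=
  [set i | star z i \in selection 2 w (s (neighbour z i)) (neighbour z i)]%SET.

Lemma exists_priority (O : {set 'I_4}) :
  exists p : 'S_4, forall i j, i \in O -> j \notin O -> (p i < p j)%N.
Proof.
(* The rank of a direction is its position in a list that begins with [O]. *)
pose l := enum O ++ enum (~: O).
have perml : perm_eq l (enum 'I_4).
  apply: uniq_perm; rewrite ?enum_uniq // /l.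
    rewrite cat_uniq !enum_uniq /= andbT; apply/hasPn => x.
    by rewrite !mem_enum inE.
  by move=> x; rewrite mem_cat !mem_enum inE orbN.
have sl : size l = 4 by rewrite (perm_size perml) size_enum_ord.
have ml i : i \in l by rewrite (perm_mem perml) mem_enum.
have lt4 i : (index i l < 4)%N by have := ml i; rewrite -index_mem sl.
have inj : injective (fun i => Ordinal (lt4 i)).
  move=> i j /(congr1 val) /= e.
  by rewrite -(nth_index i (ml i)) e nth_index.
exists (perm inj) => i j iO jO; rewrite !permE /= /l !index_cat !mem_enum iO (negPf jO).
by rewrite (leq_trans _ (leq_addr _ _))// index_mem mem_enum.
Qed.

Definition priority (O : {set 'I_4}) : 'S_4 := sval (cid (exists_priority O)).

(* An edge tied with a selected one gains weight from its other endpoint only if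
   the selected one does too. *)
Lemma settled_priority w s z : s z = priority (chosen_by_others w s z) ->
  settled (next_weight w s) z.
Proof.
move=> e; apply/settledP; exists (chosen w s z); first exact: card_chosen.
move=> i j ic jc; rewrite !next_weight_star ic (negPf jc).
have := chosen_le ic jc; rewrite leq_eqVlt => /orP[/eqP t|]; last lia.
have lt := chosen_tie ic jc t.
suff : j \in chosen_by_others w s z -> i \in chosen_by_others w s z.
  by rewrite !inE t; do 2!case: (_ \in selection _ _ _ _) => //=; lia.
move=> hj; apply: contraLR lt => hi; rewrite -leqNgt ltnW // e.
exact: (svalP (cid (exists_priority _))).
Qed.

Lemma weightS (s : nat -> site -> 'S_4) t :
  weight 2 s t.+1 = next_weight (weight 2 s t) (s t.+1).
Proof. by []. Qed.

Lemma settledS (s : nat -> site -> 'S_4) t z :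
  settled (weight 2 s t) z -> settled (weight 2 s t.+1) z.
Proof.
case/settledP => S cS h; apply/settledP; exists S => //.
by rewrite weightS; exact: settled_next.
Qed.

Lemma settled_reinforced (s : nat -> site -> 'S_4) t z :
  settled (weight 2 s t) z ->
  exists2 S : {set 'I_4}, #|S| = 2%N & forall i, i \in S ->
    forall u, (t <= u)%N -> (weight 2 s u (star z i) < weight 2 s u.+1 (star z i))%N.
Proof.
case/settledP => S cS h; exists S => // i iS u tu.
have {}h : forall i j, i \in S -> j \notin S ->
    (weight 2 s u (star z j) < weight 2 s u (star z i))%N.
  elim: u tu => [|u IH]; first by rewrite leqn0 => /eqP t0; move: h; rewrite t0.
  rewrite leq_eqVlt => /orP[/eqP tu|/IH {}IH]; first by move: h; rewrite tu.
  by rewrite weightS; exact: settled_next.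
by rewrite weightS next_weight_star (settled_chosen _ cS h) iS; lia.
Qed.

(** * Infinite paths and face clusters *)

Section Konig.
Variables (T : choiceType) (nbr : T -> seq T) (A : set T).
Local Notation adj := (fun x y : T => y \in nbr x).

(** The invariant of König's argument: [s] lists the vertices visited before [x], and simple paths
    of every length in [A] leave [x] without meeting them. *)
Definition extendible (x : T) (s : seq T) : Prop :=
  forall n, exists p, [/\ size p = n, path adj x p, uniq (x :: p),
    forall y, y \in x :: p -> y \notin s & forall y, y \in x :: p -> A y].

(** Otherwise each neighbour [y] has a length [N y] that no admissible path from [y] attains. A path
    from [x] longer than all these lengths enters some [y], and truncating it there gives a
    contradiction. *)
Lemma extendibleS x s : extendible x s ->
  exists2 y, y \in nbr x & extendible y (x :: s).
Proof.
move=> ext; apply: contrapT => noext.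
have {noext} : forall y, exists n, y \in nbr x -> forall p, ~
    [/\ size p = n, path adj y p, uniq (y :: p),
    forall z, z \in y :: p -> z \notin x :: s & forall z, z \in y :: p -> A z].
  move=> y; case: (boolP (y \in nbr x)) => [yx|]; last by exists 0%N.
  apply: contrapT => h; apply: noext; exists y => // n.
  by apply: contrapT => h'; apply: h; exists n => _ p hp; apply: h'; exists p.
case/choice => N hN.
have [[|y p] [//= sp /andP[yx pp] /andP[xp up] ps pA]] :=
  ext (\max_(y <- nbr x) N y).+1.
have Np : (N y <= size p)%N by case: sp => ->; exact: leq_bigmax_seq.
apply: (hN y yx (take (N y) p)); split.
- by rewrite size_takel.
- by rewrite take_path.
- exact: (take_uniq (N y).+1 (up : uniq (y :: p))).
- move=> z zp; have {}zp : z \in y :: p.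
    by move: zp; rewrite !inE => /orP[->//|/mem_take ->]; rewrite orbT.
  rewrite inE negb_or ps ?andbT; last by rewrite inE zp orbT.
  by apply: contraNneq xp => <-.
- move=> z zp; apply: pA.
  by move: zp; rewrite !inE => /orP[->|/mem_take ->]; rewrite !orbT.
Qed.

(** König's lemma for the locally finite graph [nbr]. It bounds components below, and it also turns
    percolation into a countable combination of events, hence a measurable one. *)
Lemma konig :
  (exists u : nat -> T,
    [/\ injective u, forall n, A (u n) & forall n, u n.+1 \in nbr (u n)]) <->
  (exists x, forall n, exists p, [/\ size p = n, path adj x p, uniq (x :: p) &
    forall y, y \in x :: p -> A y]).
Proof.
split=> [[u [ui uA ua]]|[x0 h0]].
  exists (u 0%N) => n; exists [seq u i | i <- iota 1 n].
  have E : u 0%N :: [seq u i | i <- iota 1 n] = [seq u i | i <- iota 0 n.+1] by [].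
  split; first by rewrite size_map size_iota.
  - have up k m : path adj (u m) [seq u i | i <- iota m.+1 k].
      by elim: k m => //= k IH m; rewrite ua IH.
    exact: up.
  - by rewrite E map_inj_uniq// iota_uniq.
  - by move=> y; rewrite E => /mapP[i _ ->].
have {}h0 : extendible x0 [::] by move=> n; have [p [? ? ? ?]] := h0 n; exists p.
(* A state is the current vertex with the list of earlier ones. Extendibility forbids a return to
   the list, whence injectivity. *)
pose state := {xs : T * seq T | extendible xs.1 xs.2}.
have step (a : state) : {b : state | (sval b).1 \in nbr (sval a).1 &
    (sval b).2 = (sval a).1 :: (sval a).2}.
  by apply: cid2; case: a => -[x s] /= /extendibleS[y yx ey];
    exists (exist _ (y, x :: s) ey).
pose next a := s2val (step a).
pose a_ n := iter n next (exist _ (x0, [::]) h0 : state).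
have aS1 n : (sval (a_ n.+1)).1 \in nbr (sval (a_ n)).1 := s2valP (step (a_ n)).
have aS2 n : (sval (a_ n.+1)).2 = (sval (a_ n)).1 :: (sval (a_ n)).2 :=
  s2valP' (step (a_ n)).
exists (fun n => (sval (a_ n)).1); split => //; last first.
  move=> n; have [p [_ _ _ _]] := svalP (a_ n) 0%N; apply; exact: mem_head.
have lt_neq i j : (i < j)%N -> (sval (a_ i)).1 <> (sval (a_ j)).1.
  move=> ij; have : (sval (a_ i)).1 \in (sval (a_ j)).2.
    elim: j ij => // j IH; rewrite ltnS aS2 inE leq_eqVlt => /orP[/eqP->|/IH->].
      by rewrite eqxx.
    by rewrite orbT.
  have [p [_ _ _ /(_ _ (mem_head _ _)) h _]] := svalP (a_ j) 0%N.
  by move=> hi e; move: h; rewrite -e hi.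
move=> i j e; case: (ltngtP i j) => // /lt_neq; first by move/(_ e).
by move/(_ (esym e)).
Qed.

(** By [konig], simple paths from [x] in [A] have bounded length. Any path shortens to a simple one
    with the same end, so all ends lie in a ball of fixed radius, a finite list. *)
Lemma finite_component :
  ~ (exists u : nat -> T,
    [/\ injective u, forall n, A (u n) & forall n, u n.+1 \in nbr (u n)]) ->
  forall x, exists B : seq T, forall p, path adj x p ->
    (forall y, y \in x :: p -> A y) -> last x p \in B.
Proof.
move=> nou x.
have [n hn] : exists n, forall p, path adj x p -> uniq (x :: p) ->
    (forall y, y \in x :: p -> A y) -> (size p < n)%N.
  apply: contrapT => h; apply/nou/konig; exists x => n.
  apply: contrapT => h'; apply: h; exists n => p pp up pA.
  rewrite ltnNge; apply/negP => np; apply: h'; exists (take n p); split.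
  - by rewrite size_takel.
  - by rewrite take_path.
  - exact: (take_uniq n.+1 (up : uniq (x :: p))).
  - move=> z zp; apply: pA.
    by move: zp; rewrite !inE => /orP[->//|/mem_take ->]; rewrite orbT.
pose ball k := iter k (fun l => l ++ flatten (map nbr l)) [:: x].
have ballP p : path adj x p -> last x p \in ball (size p).
  elim/last_ind: p => [|p y IH]; first by rewrite /= mem_head.
  rewrite rcons_path last_rcons size_rcons => /andP[/IH hp yn].
  by rewrite /ball /= mem_cat; apply/orP; right; apply/flatten_mapP; exists (last x p).
have ballM k l : (k <= l)%N -> {subset ball k <= ball l}.
  elim: l => [|l IH]; first by rewrite leqn0 => /eqP ->.
  rewrite leq_eqVlt => /orP[/eqP -> //|/IH h] y /h yl.
  by rewrite /ball /= mem_cat -/(ball l) yl.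
exists (ball n) => p pp pA; case/shortenP: pp pA => p' pp' up' sub pA.
apply: (ballM (size p')); last exact: ballP.
apply: ltnW; apply: hn => // y; rewrite inE => /orP[/eqP->|/sub yp].
  by apply: pA; rewrite mem_head.
by apply: pA; rewrite inE yp orbT.
Qed.

End Konig.

(** A site also stands for the unit square of which it is the lower left corner. The edge [e]
    separates the squares [e.1] and [other_face e]. *)
Definition other_face (e : edge) : site := e.1 - unit_vec (~~ e.2).

Lemma mem_square (e : edge) (f : site) :
  (e \in square f) = (f \in [:: e.1; other_face e]).
Proof.
case: e => z b; rewrite /square /other_face !inE /= !xpair_eqE.
by rewrite ![f == z - _]eq_sym !subr_eq [f == z]eq_sym; case: b; rewrite /= ?andbT ?andbF ?orbF ?orFb.
Qed.

Definition dual_neighbours (e : edge) : seq edge :=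
  square e.1 ++ square (other_face e).

Lemma dual_neighboursP (e f : edge) :
  dually_adjacent e f <-> f \in dual_neighbours e.
Proof.
rewrite /dual_neighbours mem_cat; split.
  case=> z [ez fz].
  have [zE|zE] : z = e.1 \/ z = other_face e; rewrite -?zE ?fz ?orbT//.
  by move: ez; rewrite mem_square !inE => /orP[]/eqP; [left|right].
by case/orP => h; [exists e.1|exists (other_face e)]; split => //;
  rewrite mem_square !inE eqxx ?orbT.
Qed.

Lemma percolates_duallyE (A : set edge) :
  percolates_dually A <-> exists u : nat -> edge,
    [/\ injective u, forall n, A (u n) & forall n, u n.+1 \in dual_neighbours (u n)].
Proof.
by split=> -[u [ui uA ua]]; exists u; split => // n; apply/dual_neighboursP; exact: ua.
Qed.

Inductive face_cluster (A : set edge) (f0 : site) : site -> Prop :=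
| face_cluster0 : face_cluster A f0 f0
| face_cluster_other e : A e -> face_cluster A f0 e.1 ->
    face_cluster A f0 (other_face e)
| face_cluster_base e : A e -> face_cluster A f0 (other_face e) ->
    face_cluster A f0 e.1.

(** Edges crossed one after the other bound a common face, so they are dually adjacent. A reached
    face other than [f0] thus touches the finite dual component of one of the four edges around
    [f0]. *)
Lemma finite_face_cluster (A : set edge) (f0 : site) : ~ percolates_dually A ->
  exists B : seq site, forall f, face_cluster A f0 f -> f \in B.
Proof.
move=> noperc.
have fin : forall e, exists B : seq edge, forall p,
    path (fun x y => y \in dual_neighbours x) e p ->
    (forall y, y \in e :: p -> A y) -> last e p \in B.
  by apply: finite_component => h; apply/noperc/percolates_duallyE.
case/choice: fin => B hB.
exists (f0 :: flatten [seq [:: e.1; other_face e] |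
  e <- flatten [seq B e | e <- square f0]]) => f hf.
suff [->|[e0 [p [e0f pp pA fl]]]] : f = f0 \/ exists e0 p, [/\ e0 \in square f0,
    path (fun x y => y \in dual_neighbours x) e0 p,
    forall y, y \in e0 :: p -> A y & last e0 p \in square f].
- by rewrite mem_head.
- rewrite inE; apply/orP; right; apply/flatten_mapP; exists (last e0 p).
    by apply/flatten_mapP; exists e0 => //; exact: hB.
  by rewrite -mem_square.
have step e g g' : A e -> e \in square g -> e \in square g' ->
    g = f0 \/ (exists e0 p, [/\ e0 \in square f0,
    path (fun x y => y \in dual_neighbours x) e0 p,
    forall y, y \in e0 :: p -> A y & last e0 p \in square g]) ->
    exists e0 p, [/\ e0 \in square f0,
    path (fun x y => y \in dual_neighbours x) e0 p,
    forall y, y \in e0 :: p -> A y & last e0 p \in square g'].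
  move=> Ae eg eg' [gE|[e0 [p [e0f pp pA lp]]]].
    exists e, [::]; split; rewrite -?gE// => y; by rewrite mem_seq1 => /eqP ->.
  exists e0, (rcons p e); split => //.
  - by rewrite rcons_path pp /=; apply/dual_neighboursP; exists g.
  - move=> y; rewrite -rcons_cons mem_rcons inE => /orP[/eqP->//|]; exact: pA.
  - by rewrite last_rcons.
elim: hf => [|e Ae _ IH|e Ae _ IH]; first by left.
- by right; apply: (step e e.1) => //; rewrite mem_square !inE eqxx ?orbT.
- by right; apply: (step e (other_face e)) => //; rewrite mem_square !inE eqxx ?orbT.
Qed.

(** * Circuits around finite face clusters *)

(** Walks are coded by their directions, so that those of a given length form a finite type. The
    starting site [v] is left out of the list. *)
Fixpoint walk (v : site) (s : seq 'I_4) : seq site :=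
  if s is i :: s' then neighbour v i :: walk (neighbour v i) s' else [::].

Fixpoint walk_edges (v : site) (s : seq 'I_4) : seq edge :=
  if s is i :: s' then star v i :: walk_edges (neighbour v i) s' else [::].

Lemma neighbour_back (v : site) (i : 'I_4) : exists j,
  neighbour (neighbour v i) j = v /\ star (neighbour v i) j = star v i.
Proof.
have [n0 n1 n2 n3] := neighbourE v; have [s0 s1 s2 s3] := starE v.
move: i; apply: ord4P; rewrite ?s0 ?s1 ?s2 ?s3 ?n0 ?n1 ?n2 ?n3.
- exists (inord 2); have [_ _ -> _] := neighbourE (v + unit_vec false).
  by have [_ _ -> _] := starE (v + unit_vec false); rewrite addrK.
- exists (inord 3); have [_ _ _ ->] := neighbourE (v + unit_vec true).
  by have [_ _ _ ->] := starE (v + unit_vec true); rewrite addrK.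
- exists (inord 0); have [-> _ _ _] := neighbourE (v - unit_vec false).
  by have [-> _ _ _] := starE (v - unit_vec false); rewrite subrK.
- exists (inord 1); have [_ -> _ _] := neighbourE (v - unit_vec true).
  by have [_ -> _ _] := starE (v - unit_vec true); rewrite subrK.
Qed.

Lemma star_fst (v : site) (i : 'I_4) :
  (star v i).1 = v \/ (star v i).1 = neighbour v i.
Proof.
have := endpoints_star v i => /perm_mem/(_ (star v i).1).
by rewrite /endpoints mem_head !inE => /esym/orP[]/eqP; [left|right].
Qed.

Definition boundary (K : site -> bool) (e : edge) : bool :=
  K e.1 (+) K (other_face e).

Lemma other_faceE (x y : int) (b : bool) :
  other_face ((x, y), b) = if b then (x - 1, y) else (x, y - 1).
Proof. by case: b; rewrite /other_face oppsE addsE ?subr0. Qed.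

Lemma boundaryE K (x y : int) (b : bool) :
  boundary K ((x, y), b) = K (x, y) (+) K (if b then (x - 1, y) else (x, y - 1)).
Proof. by rewrite /boundary other_faceE. Qed.

(** * Crossing parity of a boundary component *)

Section BoundaryComponent.
Variables (K : site -> bool) (v0 : site).

Definition boundary_step : rel site :=
  fun v w => [exists i, (neighbour v i == w) && boundary K (star v i)].

Definition boundary_reach (v : site) : bool :=
  `[< exists p, path boundary_step v0 p /\ last v0 p = v >].

Lemma boundary_reach_next v i : boundary K (star v i) ->
  boundary_reach v -> boundary_reach (neighbour v i).
Proof.
move=> b /asboolP[p [pp lp]]; apply/asboolP; exists (rcons p (neighbour v i)).
rewrite last_rcons rcons_path pp lp; split => //=.
by apply/existsP; exists i; rewrite eqxx.
Qed.

Lemma boundary_reach_neighbour v i : boundary K (star v i) ->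
  boundary_reach (neighbour v i) = boundary_reach v.
Proof.
move=> b; apply/idP/idP; last exact: boundary_reach_next.
have [j [nj sj]] := neighbour_back v i.
by rewrite -{2}nj; apply: boundary_reach_next; rewrite sj.
Qed.

Definition component (e : edge) : bool := boundary K e && boundary_reach e.1.

Lemma component_star v i :
  component (star v i) = boundary K (star v i) && boundary_reach v.
Proof.
rewrite /component; case b: boundary => //=.
by have [->//|->] := star_fst v i; exact: boundary_reach_neighbour.
Qed.

(** Going round [v], the four boundary indicators are the differences modulo 2 of the four faces in
    cyclic order, and so cancel. The component contains either all boundary edges at [v] or none. *)
Lemma component_even v : component (v, false) (+) component (v, true) (+)
  component (v - unit_vec false, false) (+) component (v - unit_vec true, true)
  = false.
Proof.
have [s0 s1 s2 s3] := starE v.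
rewrite -{1}s0 -{1}s1 -s2 -s3 !component_star s0 s1 s2 s3.
case: (boundary_reach v); rewrite ?andbF// !andbT.
have bF z : boundary K (z, false) = K z (+) K (z - unit_vec true) by [].
have bT z : boundary K (z, true) = K z (+) K (z - unit_vec false) by [].
rewrite !bF !bT.
have -> : v - unit_vec false - unit_vec true = v - unit_vec true - unit_vec false.
  by rewrite addrAC.
case: (K v); case: (K (v - unit_vec true)); case: (K (v - unit_vec false));
  by case: (K (v - unit_vec true - unit_vec false)).
Qed.

(** The number modulo 2 of component edges crossed by a horizontal ray that leaves the face [f] to
    the right and passes [N] vertical edges. With [N] large this tells inside from outside. *)
Definition parity (N : nat) (f : site) : bool :=
  \big[addb/false]_(j < N) component ((f.1 + j.+1%:Z, f.2), true).

Lemma addb_telescope (F : nat -> bool) N :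
  (\big[addb/false]_(j < N) F j) (+) (\big[addb/false]_(j < N) F j.+1)
  = F 0%N (+) F N.
Proof.
elim: N => [|N IH]; first by rewrite !big_ord0 !addbb.
rewrite !big_ord_recr /= addbACA IH.
by case: (F 0%N); case: (F N); case: (F N.+1).
Qed.

(** The two rays overlap except at their ends; the second term on the right is the error made by
    cutting the ray at length [N]. *)
Lemma parity_horizontal N (x y : int) :
  parity N (x - 1, y) (+) parity N (x, y) =
  component ((x, y), true) (+) component ((x + N%:Z, y), true).
Proof.
pose F (j : nat) := component ((x + j%:Z, y), true).
have -> : component ((x, y), true) = F 0%N by rewrite /F addr0.
rewrite -[component ((x + N%:Z, y), true)]/(F N) -addb_telescope.
congr (_ (+) _); apply: eq_bigr => j _ //.
by rewrite /F /=; congr (component ((_, _), _)); lia.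
Qed.

(** Lengthening both rays by one column changes the two sides equally, by [component_even] at the
    site between the two new crossings. *)
Lemma parity_vertical N (x y : int) :
  parity N (x, y) (+) parity N (x, y - 1) =
  component ((x, y), false) (+) component ((x + N%:Z, y), false).
Proof.
elim: N => [|N IH]; first by rewrite /parity !big_ord0 addr0 !addbb.
rewrite /parity !big_ord_recr /= addbACA -!/(parity N _) IH.
have := component_even (x + N.+1%:Z, y); rewrite !oppsE !addsE oppr0 !addr0.
have -> : x + N.+1%:Z - 1 = x + N%:Z by lia.
case: (component (x + N.+1%:Z, y, false)); case: (component (x + N.+1%:Z, y, true));
  case: (component (x + N%:Z, y, false)); case: (component (x, y, false));
  by case: (component (x + N.+1%:Z, y - 1, true)).
Qed.

End BoundaryComponent.

(* The component of the boundary of K through the rightmost crossing of the row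
   of (0, 0) bounds a set of faces containing K, by the parity of the crossings
   to the right; hence it also crosses the column of (0, 0). *)
Lemma boundary_walk (K : site -> bool) (R m : int) :
  (forall f, K f -> `|f.1| <= R /\ `|f.2| <= R) ->
  (forall Q : site -> bool,
    (forall e, K e.1 -> K (other_face e) -> Q e.1 = Q (other_face e)) ->
    Q (m, 0) = Q (0, 0)) ->
  K (m, 0) -> K (0, 0) -> (forall x : int, m < x -> K (x, 0) = false) ->
  exists p, path (boundary_step K) (m + 1, 0) p /\ (last (m + 1, 0) p).1 = 0.
Proof.
move=> KR Kconn Km K0 Kgt.
have R0 : 0 <= R by have [/= h _] := KR _ K0; rewrite normr0 in h.
pose g := component K (m + 1, 0).
have boundaryF (x y : int) b : (R + 1 < x) || (R + 1 < y) -> boundary K ((x, y), b) = false.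
  move=> h; rewrite boundaryE.
  have -> : K (x, y) = false by apply/negP => /KR /= [? ?]; lia.
  by apply/negP; case: b => /KR /= [? ?]; lia.
have gF (x y : int) b : (R + 1 < x) || (R + 1 < y) -> g ((x, y), b) = false.
  by move=> h; rewrite /g /component boundaryF.
(* From a face with abscissa at least [- R], a ray of this length ends beyond [R + 1], where [gF]
   kills the error terms. *)
pose N := absz (R + R + 3).
have NE : N%:Z = R + R + 3 by rewrite /N; lia.
pose Q := parity K (m + 1, 0) N.
(* The ray from [(m, 0)] crosses the component once, at its first edge; further right the row is
   free of [K]. *)
have Qm : Q (m, 0).
  rewrite /Q /parity; have -> : N = N.-1.+1 by lia.
  rewrite big_ord_recl big1 ?addbF /=.
    rewrite /component boundaryE /= addrK Km.
    rewrite Kgt /=; last lia.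
    by apply/asboolP; exists [::].
  move=> j _; apply/negbTE; rewrite negb_and; apply/orP; left.
  rewrite boundaryE /=.
  by rewrite !Kgt //; rewrite /bump /=; lia.
have QK e : K e.1 -> K (other_face e) -> Q e.1 = Q (other_face e).
  case: e => -[x y] b; rewrite other_faceE /= => K1 K2.
  have ge : g ((x, y), b) = false by rewrite /g /component boundaryE K1 K2.
  have [/= xR yR] := KR _ K1; apply/eqP; rewrite -negb_add; apply/negP.
  case: b K2 ge => /= K2 ge.
    rewrite addbC /Q parity_horizontal -/g ge gF //; lia.
  by rewrite /Q parity_vertical -/g ge gF //; lia.
have Q0 : Q (0, 0) by rewrite -(Kconn Q QK).
(* If no horizontal component edge starts in column 0, then [Q] stays true all the way up that
   column, although it is false above height [R + 1]. *)
have [y gy] : exists y, g ((0, y), false).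
  apply: contrapT => h.
  have Qn (n : nat) : Q (0, n%:Z).
    elim: n => // n IH; have := parity_vertical K (m + 1, 0) N 0 n.+1%:Z.
    have -> : n.+1%:Z - 1 = n%:Z by lia.
    rewrite -/Q IH -/g [g ((0 + _, _), _)]gF; last lia.
    case: (Q _) => //; rewrite addbF => /esym gy.
    by exfalso; apply: h; exists n.+1%:Z.
  have := Qn (absz (R + 2)); rewrite /Q /parity big1 // => j _.
  by rewrite -/g gF //=; lia.
move: gy => /andP[_ /= /asboolP[p [pp lp]]].
by exists p; rewrite lp.
Qed.

Lemma boundary_stepE K v w : boundary_step K v w ->
  exists2 i, neighbour v i = w & boundary K (star v i).
Proof. by case/existsP => i /andP[/eqP]; exists i. Qed.

Lemma neighbour_fst (v : site) (i : 'I_4) : v.1 - 1 <= (neighbour v i).1.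
Proof.
have [n0 n1 n2 n3] := neighbourE v; case: v n0 n1 n2 n3 => x y n0 n1 n2 n3.
by move: i; apply: ord4P; rewrite ?n0 ?n1 ?n2 ?n3 ?oppsE ?addsE /=; lia.
Qed.

Lemma boundary_path_fst K v p : path (boundary_step K) v p ->
  v.1 <= (last v p).1 + (size p)%:Z.
Proof.
elim: p v => [|w p IH] v /=; first by rewrite addr0.
case/andP => /boundary_stepE[i <- _] /IH.
have := neighbour_fst v i; lia.
Qed.

Lemma boundary_path_walk K v p : path (boundary_step K) v p ->
  exists s, walk v s = p /\ all (boundary K) (walk_edges v s).
Proof.
elim: p v => [|w p IH] v /=; first by exists [::].
case/andP => /boundary_stepE[i <- b] /IH[s [ws es]].
by exists (i :: s); rewrite /= ws b es.
Qed.

Lemma size_walk v s : size (walk v s) = size s.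
Proof. by elim: s v => //= i s IH v; rewrite IH. Qed.

(** Let [K] be the face cluster of [(0, 0)] after opening the edges between the faces [(0, 0)], ...,
    [(n, 0)], and [(m, 0)] its rightmost face in row 0. Edges of [A] never separate [K] from its
    complement, so a walk along the boundary of [K] avoids [A]; reaching column 0 from column
    [m + 1] makes it long. *)
Lemma exists_long_walk (A : set edge) : ~ percolates_dually A ->
  forall n, exists m s, [/\ (n <= m)%N, size s = m.+1,
    uniq ((m.+1%:Z, 0) :: walk (m.+1%:Z, 0) s) &
    forall e, e \in walk_edges (m.+1%:Z, 0) s -> ~ A e].
Proof.
move=> noperc n.
pose A' : set edge := A `|` [set e | exists2 j : nat, (j < n)%N & e = ((j.+1%:Z, 0), true)].
pose K f := `[< face_cluster A' (0, 0) f >].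
have K0 : K (0, 0) by apply/asboolP; constructor.
have Kstep e : A' e -> K e.1 = K (other_face e).
  by move=> Ae; apply/asboolP/asboolP => h; [exact: face_cluster_other|exact: face_cluster_base].
have Kj (j : nat) : (j <= n)%N -> K (j%:Z, 0).
  elim: j => // j IH jn; have := Kstep ((j.+1%:Z, 0), true).
  rewrite other_faceE => ->.
    by have -> : j.+1%:Z - 1 = j%:Z by [lia]; apply: IH; exact: ltnW.
  by right; exists j.
(* Crossing one of the added edges leads to some [(j, 0)] with [j <= n], so [K] is covered by
   [n + 1] finite clusters of [A]. *)
have [B hB] : exists B : seq site, forall f, K f -> f \in B.
  have : forall j : nat, exists B : seq site, forall f, face_cluster A (j%:Z, 0) f -> f \in B.
    by move=> j; exact: finite_face_cluster.
  case/choice => B hB; exists (flatten [seq B j | j <- iota 0 n.+1]) => f /asboolP Kf.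
  suff [j jn hj] : exists2 j : nat, (j <= n)%N & face_cluster A (j%:Z, 0) f.
    apply/flatten_mapP; exists j; last exact: hB.
    by rewrite mem_iota add0n ltnS.
  elim: Kf => [|e [Ae|[j jn eE]] _ [i ni hi]|e [Ae|[j jn eE]] _ [i ni hi]].
  - by exists 0%N => //; constructor.
  - by exists i => //; exact: face_cluster_other.
  - exists j; first exact: ltnW.
    rewrite eE other_faceE.
    have -> : j.+1%:Z - 1 = j%:Z by lia.
    by constructor.
  - by exists i => //; exact: face_cluster_base.
  - by exists j.+1 => //; rewrite eE /=; constructor.
have [R KR] : exists R : int, forall f, K f -> `|f.1| <= R /\ `|f.2| <= R.
  exists (\sum_(f <- B) (`|f.1| + `|f.2|)) => f /hB fB.
  rewrite (big_rem f fB) /=.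
  have : 0 <= \sum_(y <- rem f B) (`|y.1| + `|y.2|) :> int.
    by apply: sumr_ge0 => i _; rewrite addr_ge0.
  by move: (\sum_(y <- _) _) => S; lia.
have [m [Km nm Kgt]] : exists m : nat, [/\ K (m%:Z, 0), (n <= m)%N &
    forall x : int, m%:Z < x -> K (x, 0) = false].
  have exK : exists m : nat, K (m%:Z, 0) by exists n; exact: Kj.
  have ubK (m : nat) : K (m%:Z, 0) -> (m <= absz R)%N.
    by move=> /KR[/= h _]; lia.
  have [m Km mmax] := ex_maxnP exK ubK.
  exists m; split => //; first by apply: mmax; exact: Kj.
  move=> x mx; apply/negP => Kx.
  by have := mmax (absz x); rewrite gez0_abs; [move/(_ Kx); lia|lia].
(* [boundary_walk] takes the connectedness of [K] as the invariance of face predicates; it follows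
   by induction on cluster membership. *)
have [] := @boundary_walk K R m%:Z KR _ Km K0 Kgt.
  move=> Q hQ; move/asboolP: Km; elim => // e Ae he IH; rewrite -IH.
    by apply/esym/hQ; apply/asboolP => //; exact: face_cluster_other.
  by apply/hQ; apply/asboolP => //; exact: face_cluster_base.
have -> : m%:Z + 1 = m.+1%:Z by lia.
(* Loops are erased first, and the first [m.+1] steps of the resulting self-avoiding walk are
   kept. *)
move=> p [pp lp]; case/shortenP: pp lp => p' pp' up' _ lp.
have sp : (m.+1 <= size p')%N.
  by have := boundary_path_fst pp'; rewrite lp /=.
have [s [ws es]] := boundary_path_walk (take_path m.+1 pp').
exists m, s; split => //.
- by rewrite -(size_walk (m.+1%:Z, 0)) ws size_takel.
- by rewrite ws; exact: (take_uniq m.+2 up').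
- move=> e /(allP es) + Ae; rewrite /boundary Kstep ?addbb//.
  by left.
Qed.

(** * Discrete random variables and independence *)

Section DiscreteVariables.
Context (d : measure_display) (T : measurableType d).

Lemma discrete_preimage (V : countType) (X : T -> V) (B : set V) :
  discrete_rv X -> measurable (X @^-1` B).
Proof.
move=> mX.
have -> : X @^-1` B = \bigcup_v (if v \in B then X @^-1` [set v] else set0).
  apply/seteqP; split=> x /=; first by exists (X x); rewrite ?mem_set.
  by case=> v _; case: ifPn => //; rewrite inE => Bv /= ->.
by apply: countable_bigcupT_measurable => // v; case: ifP.
Qed.

Lemma discrete_comp (V W : countType) (g : V -> W) (X : T -> V) :
  discrete_rv X -> discrete_rv (g \o X).
Proof. by move=> mX w; exact: (discrete_preimage (g @^-1` [set w]) mX). Qed.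

Lemma discrete_pair (V W : countType) (X : T -> V) (Y : T -> W) :
  discrete_rv X -> discrete_rv Y -> discrete_rv (fun x => (X x, Y x)).
Proof.
move=> mX mY [v w].
have -> : (fun x => (X x, Y x)) @^-1` [set (v, w)] = X @^-1` [set v] `&` Y @^-1` [set w].
  by apply/seteqP; split=> x /= [-> ->].
exact: measurableI.
Qed.

Lemma discrete_ffun (I : finType) (V : countType) (F : I -> T -> V) :
  (forall i, discrete_rv (F i)) -> discrete_rv (fun x => [ffun i => F i x]).
Proof.
move=> mF u.
have -> : (fun x => [ffun i => F i x]) @^-1` [set u] =
    \bigcap_(i in [set: I]) F i @^-1` [set u i].
  apply/seteqP; split=> x /=; first by move=> <- i _ /=; rewrite ffunE.
  by move=> h; apply/ffunP => i; rewrite ffunE; exact: h.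
by apply: fin_bigcap_measurable => // i _; exact: mF.
Qed.

End DiscreteVariables.

(** The order at a site as a function of only four weights and a permutation, thus of a value in a
    countable type, to which [discrete_comp] applies. *)
Definition local_precedes (u : {ffun 'I_4 -> nat}) (p : 'S_4) : rel 'I_4 :=
  fun i j => (u j < u i)%N || (u i == u j) && (p i <= p j)%N.

Lemma selection_local w p z : selection 2 w p z =
  map (star z) (take 2 (sort (local_precedes [ffun i => w (star z i)] p) (enum 'I_4))).
Proof.
rewrite /selection; congr (map _ (take _ (sort _ _))).
by apply/funext => i; apply/funext => j; rewrite /precedes /local_precedes !ffunE.
Qed.

Section DiscreteWeights.
Context (d : measure_display) (T : measurableType d).

Lemma discrete_selection (w : T -> edge -> nat) (p : T -> 'S_4) z e :
  (forall f, discrete_rv (fun x => w x f)) -> discrete_rv p ->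
  discrete_rv (fun x => e \in selection 2 (w x) (p x) z).
Proof.
move=> mw mp.
have -> : (fun x => e \in selection 2 (w x) (p x) z) =
    (fun up => e \in map (star z) (take 2 (sort (local_precedes up.1 up.2) (enum 'I_4)))) \o
    (fun x => ([ffun i => w x (star z i)], p x)).
  by apply/funext => x /=; rewrite selection_local.
apply: discrete_comp; apply: discrete_pair => //.
by apply: (discrete_ffun (F := fun i x => w x (star z i))) => i; exact: mw.
Qed.

(** Assuming measurability only up to round [t] allows the use of a sigma-algebra that omits a tie
    break of round [t.+1]. *)
Lemma discrete_weight (s : nat -> site -> T -> 'S_4) t :
  (forall u z, (u <= t)%N -> discrete_rv (s u z)) ->
  forall e, discrete_rv (fun x => weight 2 (fun u z => s u z x) t e).
Proof.
elim: t => [|t IH] ms e.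
  have : discrete_rv (fun _ : T => tt).
    by move=> []; rewrite (_ : _ @^-1` _ = setT) //; apply/seteqP; split.
  exact: (discrete_comp (fun _ : unit => 1%N)).
have {}IH := IH (fun u z ut => ms u z (leqW ut)).
pose b z x : bool := e \in selection 2 (weight 2 (fun u z => s u z x) t) (s t.+1 z x) z.
have mb z : discrete_rv (b z) by apply: discrete_selection => //; exact: ms.
pose a1 := e.1; pose a2 := e.1 + unit_vec e.2.
pose g (v : nat * (bool * bool)) := (v.1 + (v.2.1 + (v.2.2 + 0)))%N.
exact: (discrete_comp g (discrete_pair (IH e) (discrete_pair (mb a1) (mb a2)))).
Qed.

Lemma discrete_settled (w : T -> edge -> nat) z :
  (forall f, discrete_rv (fun x => w x f)) ->
  discrete_rv (fun x => settled (w x) z).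
Proof.
move=> mw.
pose g (u : {ffun 'I_4 -> nat}) := [exists S : {set 'I_4}, (#|S| == 2%N) &&
    [forall i in S, forall j in ~: S, (u j < u i)%N]].
have -> : (fun x => settled (w x) z) = g \o (fun x => [ffun i => w x (star z i)]).
  apply/funext => x; rewrite /settled /g /=; apply: eq_existsb => S.
  congr (_ && _); apply: eq_forallb => i; congr (_ ==> _).
  by apply: eq_forallb => j; rewrite !ffunE.
apply: discrete_comp.
by apply: (discrete_ffun (F := fun i x => w x (star z i))) => i; exact: mw.
Qed.

Lemma discrete_chosen_by_others (w : T -> edge -> nat) (s : T -> site -> 'S_4) z :
  (forall f, discrete_rv (fun x => w x f)) ->
  (forall i, discrete_rv (fun x => s x (neighbour z i))) ->
  discrete_rv (fun x => chosen_by_others (w x) (s x) z).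
Proof.
move=> mw ms.
pose F i x := star z i \in selection 2 (w x) (s x (neighbour z i)) (neighbour z i).
have -> : (fun x => chosen_by_others (w x) (s x) z) =
    (fun u : {ffun 'I_4 -> bool} => [set i | u i]%SET) \o (fun x => [ffun i => F i x]).
  by apply/funext => x; apply/setP => i; rewrite !inE ffunE.
by apply: discrete_comp; apply: discrete_ffun => i; exact: discrete_selection.
Qed.

End DiscreteWeights.

Section Independence.
Context (d : measure_display) (T : measurableType d) (R : realType).
Variable P : probability T R.

(** As functions of [A], both sides are finite measures. They agree on the cylinder events [G], a
    pi-system that generates the sigma-algebra of the other variables, hence on all of it. *)
Lemma independent_of_others (I : choiceType) (V : countType) (X : I -> T -> V) i0 :
  (forall i, discrete_rv (X i)) -> mutually_independent P X ->
  forall (p : V) A,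
    <<s [set A | exists i v, i != i0 /\ A = X i @^-1` [set v]] >> A ->
    P (A `&` X i0 @^-1` [set p]) = (P A * P (X i0 @^-1` [set p]))%E.
Proof.
move=> mX indX p A sA.
pose G := [set A | exists (J : seq I) (B : I -> set V), [/\ uniq J, i0 \notin J &
   A = \bigcap_(i in [set` J]) X i @^-1` B i]].
have mE : measurable (X i0 @^-1` [set p]) by exact: mX.
have GI : setI_closed G.
  move=> _ _ [J1 [B1 [u1 n1 ->]]] [J2 [B2 [u2 n2 ->]]].
  exists (undup (J1 ++ J2)), (fun i =>
    (if i \in J1 then B1 i else setT) `&` (if i \in J2 then B2 i else setT)).
  split; first exact: undup_uniq.
    by rewrite mem_undup mem_cat negb_or n1 n2.
  apply/seteqP; split=> x /=.
    move=> [h1 h2] i /=; rewrite mem_undup mem_cat => _.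
    by split; case: ifP => // ij; [exact: h1|exact: h2].
  move=> h; split=> i /= ij; have := h i; rewrite /= mem_undup mem_cat ij ?orbT;
    by move=> /(_ isT)[]; rewrite ?ij.
have Gm : G `<=` measurable.
  move=> _ [J [B [_ _ ->]]]; apply: fin_bigcap_measurable => // i _.
  exact: discrete_preimage.
have GT : G setT.
  by exists [::], (fun=> setT); split => //; apply/seteqP; split.
have q0 : 0 <= fine (P (X i0 @^-1` [set p])) by rewrite fine_ge0// measure_ge0.
have PE : P (X i0 @^-1` [set p]) = (fine (P (X i0 @^-1` [set p])))%:E.
  by rewrite fineK// fin_num_measure.
have scaleE B : mscale (NngNum q0) P B = (P (X i0 @^-1` [set p]) * P B)%E.
  by rewrite [in RHS]PE.
rewrite muleC -scaleE.
apply: (@g_sigma_algebra_measure_unique _ R T G Gm (fun=> setT) (fun=> GT) _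
  (mrestr P mE) (mscale (NngNum q0) P) GI).
- by rewrite bigcup_const //; exists 0%N.
- move=> _ [J [B [uJ nJ ->]]]; apply: etrans _ (esym (scaleE _)).
  rewrite /mrestr.
  pose B' i := if i == i0 then [set p] else B i.
  have uJ' : uniq (i0 :: J) by rewrite /= nJ.
  have := indX (i0 :: J) B' uJ'; rewrite big_cons.
  have neq i : i \in J -> (i == i0) = false.
    by move=> iJ; apply/negP => /eqP ii; rewrite -ii iJ in nJ.
  have -> : (\prod_(j <- J) P (X j @^-1` B' j) = P (\bigcap_(i in [set` J]) X i @^-1` B i))%E.
    rewrite indX // !big_seq; apply: eq_bigr => i iJ.
    by rewrite /B' neq.
  have -> : B' i0 = [set p] by rewrite /B' eqxx.
  move=> <-; congr (P _); apply/seteqP; split => x /=.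
    move=> [h1 h2] i /=; rewrite inE => /orP[/eqP ->|iJ]; first by rewrite /B' eqxx.
    by rewrite /B' neq//; exact: h1.
  move=> h; split=> [i /= iJ|].
    by have := h i; rewrite /= inE iJ orbT /B' neq // => /(_ isT).
  by have := h i0; rewrite /= mem_head /B' eqxx => /(_ isT).
- move=> k; rewrite /= /mrestr setTI; rewrite PE ltry//.
- apply: smallest_sub sA; first exact: smallest_sigma_algebra.
  move=> _ [i [v [ii ->]]]; apply: sub_sigma_algebra.
  exists [:: i], (fun=> [set v]); split => //; first by rewrite inE eq_sym.
  apply/seteqP; split => x /=; first by move=> h j /=; rewrite inE => /eqP ->.
  by apply; rewrite /= inE.
Qed.

Lemma probability_partition (I : finType) (F : I -> set T) :
  (forall i, measurable (F i)) ->
  (forall i j x, F i x -> F j x -> i = j) ->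
  P (\bigcup_i F i) = (\sum_i P (F i))%E.
Proof.
move=> mF tF; rewrite measure_fin_bigcup //; last first.
  by move=> i j _ _ [x [Fi Fj]]; exact: tF Fi Fj.
  exact: finite_finset.
apply/esym; rewrite (fsbig_seq _ _ (index_enum_uniq I)).
suff -> : [set` index_enum I] = setT by [].
by apply/seteqP; split => i //= _; exact: mem_index_enum.
Qed.

End Independence.

(** * Almost every site settles *)

(** Increments are integers, so exceeding 1/2 already makes them positive. The threshold is below 1
    because the supremum that defines the lower limit need not be attained. *)
Lemma eventually_reinforcedP (R : realType) (w : nat -> edge -> nat) (e : edge) :
  eventually_reinforced R w e <->
  exists N, forall t, (N <= t)%N -> (w t e < w t.+1 e)%N.
Proof.
rewrite /eventually_reinforced /= limn_einf_lim.
set u := fun t => _; rewrite (cvg_lim _ (cvg_einfs_sup (u := u)))//; split.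
  move=> sup1; have : ((2^-1 : R)%:E < ereal_sup (range (einfs u)))%E.
    by apply: lt_le_trans sup1; rewrite lte_fin; lra.
  move=> /ereal_sup_gt[_ [N _ <-] infN]; exists N => t Nt.
  have : (2^-1%:E < u t)%E.
    by apply: (lt_le_trans infN); apply: ereal_inf_lbound; exists t.
  rewrite /u lte_fin; case: ltnP => // le.
  have : (w t.+1 e)%:R <= (w t e)%:R :> R by rewrite ler_nat.
  lra.
move=> [N hN]; apply: (@le_trans _ _ (einfs u N)); last first.
  by apply: ereal_sup_ubound; exists N.
apply: le_ereal_inf_tmp => _ [t /= /hN lt <-].
by rewrite /u lee_fin lerBrDr nat1r ler_nat.
Qed.

Section Settling.
Context (d : measure_display) (T : measurableType d) (R : realType).
Variables (P : probability T R) (sigma : nat -> site -> T -> 'S_4).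
Hypothesis sigma_unif : uniform_tie_breaking P sigma.

Let W t x := weight 2 (fun u y => sigma u y x) t.

Let discrete_sigma t z : discrete_rv (sigma t z).
Proof. by case: sigma_unif. Qed.

Lemma discrete_sigma_weight t e : discrete_rv (fun x => W t x e).
Proof. by apply: discrete_weight. Qed.

Definition unsettled z t : set T := [set x | ~~ settled (W t x) z].

Lemma measurable_unsettled z t : measurable (unsettled z t).
Proof.
have := discrete_settled z (discrete_sigma_weight t) => /(_ false).
by congr measurable; apply/seteqP; split => x /=; [move/negbT|move/negbTE].
Qed.

(** The tie breaks other than that of [z] in round [t.+1] determine whether [z] is unsettled after
    round [t] and which permutation would settle it. That permutation is drawn independently with
    probability 1/24, as 4! = 24. *)
Lemma unsettledS z t : (P (unsettled z t.+1) <= (23 / 24)%:E * P (unsettled z t))%E.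
Proof.
have [_ unif indep] := sigma_unif.
pose O x := chosen_by_others (W t x) (fun y => sigma t.+1 y x) z.
pose A p := unsettled z t `&` [set x | priority (O x) = p].
pose G := [set A | exists (i : nat * site) (v : 'S_4),
  i != (t.+1, z) /\ A = sigma i.1 i.2 @^-1` [set v]].
(* The same space with the sigma-algebra of these other tie breaks, on which the measurability
   lemmas are applied anew. *)
pose T' := g_sigma_algebraType G.
have mG i y : (i, y) != (t.+1, z) -> @discrete_rv _ T' _ (sigma i y).
  by move=> iy v; apply: sub_sigma_algebra; exists (i, y), v.
have mW e : @discrete_rv _ T' _ (fun x => W t x e).
  apply: discrete_weight => u y ut; apply: mG; rewrite xpair_eqE.
  by rewrite ltn_eqF ?ltnS.
have mO : @discrete_rv _ T' _ O.
  apply: discrete_chosen_by_others => // i; apply: mG.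
  by rewrite xpair_eqE negb_and neighbour_neq orbT.
have mA' p : <<s G >> (A p).
  apply: (@measurableI _ T').
    have := discrete_settled z mW => /(_ false).
    by congr measurable; apply/seteqP; split => x /=; [move/negbT|move/negbTE].
  exact: (discrete_comp priority mO).
have mA p : measurable (A p).
  apply: (smallest_sub (@sigma_algebra_measurable _ T) _ (mA' p)).
  by move=> _ [i [v [_ ->]]]; exact: discrete_sigma.
have mB p : measurable (A p `&` sigma t.+1 z @^-1` [set p]).
  by apply: measurableI => //; exact: discrete_sigma.
have PB p : P (A p `&` sigma t.+1 z @^-1` [set p]) = (P (A p) * (24^-1)%:E)%E.
  rewrite (@independent_of_others _ _ _ P _ _ (fun i => sigma i.1 i.2) (t.+1, z) _ indep) //.
  by rewrite /= unif.
have -> : unsettled z t.+1 = unsettled z t `&` unsettled z t.+1.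
  apply/seteqP; split => x /=; last by case.
  move=> h; split => //; move: h; apply: contra; exact: settledS.
(* On [B] the drawn permutation is the wanted one, so [z] is settled after round [t.+1]. *)
pose B := \bigcup_p (A p `&` sigma t.+1 z @^-1` [set p]).
have PBE : P B = (P (unsettled z t) * (24^-1)%:E)%E.
  rewrite /B probability_partition //; last first.
    by move=> p q x [_ /= <-] [_ /= <-].
  under eq_bigr do rewrite PB.
  rewrite -ge0_sume_distrl //; congr (_ * _)%E.
  rewrite -probability_partition //; last by move=> p q x [_ /= <-] [_ /= <-].
  congr (P _); apply/seteqP; split => x; first by case=> p _ [].
  by move=> h; exists (priority (O x)).
have mBB : measurable B.
  by apply: fin_bigcup_measurable => //; exact: finite_finset.
have Bsub : B `<=` unsettled z t by move=> x [p _ [[]]].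
apply: (@le_trans _ _ (P (unsettled z t `\` B))).
  apply: le_measure; rewrite ?inE.
  - by apply: measurableI; exact: measurable_unsettled.
  - by apply: measurableD => //; exact: measurable_unsettled.
  - move=> x [h h1]; split => // -[p _ [[_ /= pr] sp]]; move: h1.
    apply/negP; rewrite negbK /W weightS; apply: settled_priority.
    by rewrite sp -pr.
have -> : P (unsettled z t `\` B) = (P (unsettled z t) - P B)%E.
  rewrite -{2}(setIidr Bsub); apply: measureD => //.
    exact: measurable_unsettled.
  by rewrite -ge0_fin_numE// fin_num_measure//; exact: measurable_unsettled.
rewrite PBE.
have /fineK <- : P (unsettled z t) \is a fin_num.
  by rewrite fin_num_measure//; exact: measurable_unsettled.
by rewrite -!EFinM -EFinB lee_fin; lra.
Qed.

Lemma unsettled_bound z t : (P (unsettled z t) <= ((23 / 24) ^+ t)%:E)%E.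
Proof.
elim: t => [|t IH]; first by rewrite expr0 probability_le1 //; exact: measurable_unsettled.
apply: (le_trans (unsettledS z t)); rewrite exprS (EFinM (23 / 24)).
by apply: lee_wpmul2l => //; rewrite lee_fin; lra.
Qed.

Lemma ae_settled : P.-negligible [set x | exists z, forall t, ~~ settled (W t x) z].
Proof.
have neg z : P.-negligible (\bigcap_t unsettled z t).
  have m : measurable (\bigcap_t unsettled z t).
    by apply: bigcapT_measurable => t; exact: measurable_unsettled.
  suff P0 : (P (\bigcap_t unsettled z t) <= 0)%E.
    by apply/negligibleP => //; apply/eqP; rewrite eq_le measure_ge0 andbT.
  have /fineK <- : P (\bigcap_t unsettled z t) \is a fin_num by rewrite fin_num_measure.
  rewrite lee_fin.
  have r1 : `|23 / 24 : R| < 1 by rewrite ger0_norm; lra.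
  have cvg0 := cvg_expr r1.
  rewrite leNgt; apply/negP => x0.
  have /cvgrPdist_lt/(_ _ x0)[t _ /(_ t (leqnn t))] := cvg0.
  apply/negP; rewrite -leNgt sub0r normrN ger0_norm; last by rewrite exprn_ge0; lra.
  rewrite -lee_fin fineK ?fin_num_measure //.
  apply: le_trans (unsettled_bound z t); apply: le_measure; rewrite ?inE //.
    exact: measurable_unsettled.
  by move=> x; exact.
pose F n := if unpickle n is Some z then \bigcap_t unsettled z t else set0.
have : P.-negligible (\bigcup_n F n).
  by apply: negligible_bigcup => n; rewrite /F; case: unpickle => // ; exact: negligible_set0.
apply: negligibleS => x [z hz]; exists (pickle z) => //.
by rewrite /F pickleK => t _; exact: hz.
Qed.

(** Outside this null set every site has two directions of reinforced edges, hence at most two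
    unreinforced ones. *)
Lemma ae_reinforced_degree : P.-negligible [set x | exists z,
  forall S : {set 'I_4}, #|S| = 2%N ->
    exists2 i, i \in S & ~ reinforced_edges R 2 sigma x (star z i)].
Proof.
apply: negligibleS ae_settled => x [z hz]; exists z => t; apply/negP.
move=> /settled_reinforced[S cS hS]; have [i iS] := hz S cS; apply.
by apply/eventually_reinforcedP; exists t; exact: hS.
Qed.

End Settling.

(** * Long unreinforced walks *)

(** The edge [star v k] is the one by which the walk entered [v]. Neither walk goes back along it,
    so with at most two edges of [H] at [v] both continue the same way. *)
Lemma walk_unique (H : set edge) :
  (forall z i j k, H (star z i) -> H (star z j) -> H (star z k) ->
    [\/ i = j, j = k | i = k]) ->
  forall s s' v k, size s = size s' -> H (star v k) ->
  neighbour v k \notin walk v s -> neighbour v k \notin walk v s' ->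
  uniq (v :: walk v s) -> uniq (v :: walk v s') ->
  (forall e, e \in walk_edges v s -> H e) ->
  (forall e, e \in walk_edges v s' -> H e) -> s = s'.
Proof.
move=> degree; elim=> [|i s IH] [|j s'] v k //= [ss] Hk.
rewrite !inE !negb_or => /andP[ki ks] /andP[kj ks'] /andP[/andP[_ vs] us].
move=> /andP[/andP[_ vs'] us'] Hs Hs'.
have Hi : H (star v i) by apply: Hs; rewrite mem_head.
have Hj : H (star v j) by apply: Hs'; rewrite mem_head.
have ij : i = j.
  have [//|jk|ik] := degree _ _ _ _ Hi Hj Hk.
    by rewrite jk eqxx in kj.
  by rewrite ik eqxx in ki.
subst j; congr (_ :: _); have [l [nl sl]] := neighbour_back v i.
apply: (IH _ (neighbour v i) l) => //; rewrite ?sl ?nl//.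
- by move=> e es; apply: Hs; rewrite inE es orbT.
- by move=> e es; apply: Hs'; rewrite inE es orbT.
Qed.

Lemma endpoints_walk_edges v s e y : e \in walk_edges v s -> y \in endpoints e ->
  y \in v :: walk v s.
Proof.
elim: s v => //= i s IH v; rewrite inE => /orP[/eqP ->|es ye].
  by rewrite (perm_mem (endpoints_star v i)) !inE => /orP[->|->]; rewrite ?orbT.
by rewrite inE (IH (neighbour v i)) ?orbT.
Qed.

Lemma uniq_walk_edges v s : uniq (v :: walk v s) -> uniq (walk_edges v s).
Proof.
elim: s v => //= i s IH v /andP[vs us]; rewrite IH // andbT.
apply: contra vs => /endpoints_walk_edges; apply.
by rewrite (perm_mem (endpoints_star v i)) mem_head.
Qed.

Lemma size_walk_edges v s : size (walk_edges v s) = size s.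
Proof. by elim: s v => //= i s IH v; rewrite IH. Qed.

(** The space is arbitrary so that the lemma also applies to the sigma-algebra generated by the
    weights, as independence from the sprinkling requires. *)
Lemma measurable_reinforced (R : realType) d (T : measurableType d)
    (w : nat -> edge -> T -> nat) e :
  (forall t, discrete_rv (w t e)) ->
  measurable [set x | eventually_reinforced R (fun t f => w t f x) e].
Proof.
move=> mw.
have -> : [set x | eventually_reinforced R (fun t f => w t f x) e] =
    \bigcup_N \bigcap_(t in [set t | (N <= t)%N]) [set x | (w t e x < w t.+1 e x)%N].
  apply/seteqP; split=> x /=.
    by move=> /eventually_reinforcedP[N h]; exists N.
  by case=> N _ h; apply/eventually_reinforcedP; exists N.
apply: bigcupT_measurable => N; apply: bigcap_measurableType => t _.
exact: (discrete_preimage [set v | (v.1 < v.2)%N] (discrete_pair (mw t) (mw t.+1))).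
Qed.

Lemma measurable_percolates_dually d (T : measurableType d) (A : T -> set edge) :
  (forall e, measurable [set x | A x e]) ->
  measurable [set x | percolates_dually (A x)].
Proof.
move=> mA.
pose F e n p := if [&& size p == n, path (fun f g => g \in dual_neighbours f) e p
    & uniq (e :: p)]
  then \bigcap_(f in [set` e :: p]) [set x | A x f] else set0.
have -> : [set x | percolates_dually (A x)] =
    \bigcup_(e : edge) \bigcap_n \bigcup_(p : seq edge) F e n p.
  apply/seteqP; split=> x /=.
    move/percolates_duallyE/konig => [e he]; exists e => // n _.
    have [p [sp pp up pA]] := he n; exists p => //.
    by rewrite /F sp eqxx pp up.
  case=> e _ he; apply/percolates_duallyE/konig; exists e => n.
  have [p _] := he n I; rewrite /F; case: ifP => // /and3P[/eqP sp pp up] pA.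
  by exists p.
apply: countable_bigcupT_measurable; first exact: countableP.
move=> e; apply: bigcapT_measurable => n.
apply: countable_bigcupT_measurable; first exact: countableP.
move=> p; rewrite /F; case: ifP => // _.
exact: fin_bigcap_measurable.
Qed.

Section LongWalks.
Context (R : realType) (d : measure_display) (T : measurableType d).
Variables (P : probability T R) (eps : R).
Variables (sigma : nat -> site -> T -> 'S_4) (spr : edge -> T -> bool).
Hypothesis sigma_unif : uniform_tie_breaking P sigma.
Hypothesis spr_bern : bernoulli_percolation P eps spr.
Hypothesis spr_indep : independent_families P (weight_process 2 sigma) spr.

Definition unreinforced (s : seq edge) : set T :=
  \bigcap_(e in [set` s]) [set x | ~ reinforced_edges R 2 sigma x e].

Definition unsprinkled (s : seq edge) : set T :=
  \bigcap_(e in [set` s]) spr e @^-1` [set false].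

Lemma generated_unreinforced s : generated_by (weight_process 2 sigma) (unreinforced s).
Proof.
rewrite /generated_by; set G := [set A | _]; pose T' := g_sigma_algebraType G.
apply: (@fin_bigcap_measurable _ T') => // e _; apply: (@measurableC _ T').
apply: (@measurable_reinforced R _ T' (fun t f x => weight_process 2 sigma (t, f) x)).
by move=> t v; apply: sub_sigma_algebra; exists (t, e), v.
Qed.

Lemma generated_unsprinkled s : generated_by spr (unsprinkled s).
Proof.
rewrite /generated_by; set G := [set A | _]; pose T' := g_sigma_algebraType G.
apply: (@fin_bigcap_measurable _ T') => // e _; apply: sub_sigma_algebra.
by exists e, false.
Qed.

Lemma measurable_reinforced_edges e :
  measurable [set x | reinforced_edges R 2 sigma x e].
Proof.
apply: (@measurable_reinforced R _ T (fun t f x => weight_process 2 sigma (t, f) x)).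
by move=> t; exact: (discrete_sigma_weight sigma_unif).
Qed.

Lemma measurable_unreinforced s : measurable (unreinforced s).
Proof.
by apply: fin_bigcap_measurable => // e _; exact/measurableC/measurable_reinforced_edges.
Qed.

Lemma measurable_unsprinkled s : measurable (unsprinkled s).
Proof. by case: spr_bern => mspr _ _; apply: fin_bigcap_measurable => // e _; exact: mspr. Qed.

Lemma probability_unsprinkled s : uniq s -> P (unsprinkled s) = ((1 - eps) ^+ size s)%:E.
Proof.
case: spr_bern => mspr Pspr indep us; rewrite /unsprinkled indep //.
have Pf e : P (spr e @^-1` [set false]) = (1 - eps)%:E.
  have -> : spr e @^-1` [set false] = ~` (spr e @^-1` [set true]).
    by apply/seteqP; split => x /=; case: (spr e x).
  apply: (etrans (probability_setC P (mspr e true))).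
  by rewrite EFinB; congr (_ - _)%E; exact: Pspr.
under eq_bigr do rewrite Pf.
by elim: s {us} => [|e s IH]; rewrite ?big_nil ?expr0 // big_cons IH exprS EFinM.
Qed.

(** Closed means avoiding both the reinforced and the sprinkled edges, not returning to the start.
    Direction lists that revisit a site give the empty event. *)
Definition closed_walk v (s : seq 'I_4) : set T :=
  if uniq (v :: walk v s) then
    unreinforced (walk_edges v s) `&` unsprinkled (walk_edges v s)
  else set0.

Definition exists_closed_walk v m : set T :=
  \bigcup_(a : 'I_4 * m.-tuple 'I_4) closed_walk v (a.1 :: a.2).

Lemma measurable_closed_walk v s : measurable (closed_walk v s).
Proof.
rewrite /closed_walk; case: ifP => // _; apply: measurableI.
  exact: measurable_unreinforced.
exact: measurable_unsprinkled.
Qed.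

Lemma measurable_exists_closed_walk v m : measurable (exists_closed_walk v m).
Proof.
apply: fin_bigcup_measurable; first exact: finite_finset.
by move=> s _; exact: measurable_closed_walk.
Qed.

(* Where at most two edges at each site are unreinforced, a self-avoiding
   walk of unreinforced edges is determined by its first step. *)
Lemma sum_unreinforced_walks v i m :
  (\sum_(s : m.-tuple 'I_4 | uniq (v :: walk v (i :: s)))
    P (unreinforced (walk_edges v (i :: s))) <= 1)%E.
Proof.
have [B [mB B0 degB]] := ae_reinforced_degree sigma_unif.
(* Removing the null set [B] makes these events pairwise disjoint, so the sum is the probability of
   their union. *)
pose F (s : m.-tuple 'I_4) := if uniq (v :: walk v (i :: s)) then
  unreinforced (walk_edges v (i :: s)) `\` B else set0.
have mF s : measurable (F s).
  by rewrite /F; case: ifP => // _; apply: measurableD => //; exact: measurable_unreinforced.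
have -> : (\sum_(s : m.-tuple 'I_4 | uniq (v :: walk v (i :: s)))
    P (unreinforced (walk_edges v (i :: s))) = P (\bigcup_s F s))%E.
  rewrite probability_partition //.
    rewrite big_mkcond; apply: eq_bigr => s _; rewrite /F; case: ifP => // _.
      set U := unreinforced _; have mU : measurable U by exact: measurable_unreinforced.
      have -> : (P U = P (U `\` B) + P (U `&` B))%E by exact: measureDI.
      suff -> : P (U `&` B) = 0%E by rewrite adde0.
      apply/eqP; rewrite eq_le measure_ge0 andbT -B0.
      apply: le_measure; rewrite ?inE //.
      exact: measurableI.
  move=> s s' x; rewrite /F; case: ifP => // us [hs nB]; case: ifP => // us' [hs' _].
  apply/val_inj => /=; have [j [nj sj]] := neighbour_back v i.
  (* The comparison starts after the common first step [i], with the edge back to [v] as entering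
     edge. *)
  apply: (@walk_unique [set e | ~ reinforced_edges R 2 sigma x e] _ s s'
    (neighbour v i) j).
  - move=> z a b c Ha Hb Hc.
    have [S cS hS] : exists2 S : {set 'I_4}, #|S| = 2%N &
        forall i, i \in S -> reinforced_edges R 2 sigma x (star z i).
      apply: contrapT => h; apply/nB/degB; exists z => S cS.
      apply: contrapT => h'; apply: h; exists S => // a' aS.
      by apply: contrapT => h''; apply: h'; exists a'.
    have aS a' : ~ reinforced_edges R 2 sigma x (star z a') -> a' \in ~: S.
      by move=> h; rewrite inE; apply/negP => /hS.
    have [->|ab] := eqVneq a b; first by constructor 1.
    have [->|bc] := eqVneq b c; first by constructor 2.
    have [->|ac] := eqVneq a c; first by constructor 3.
    (* Three distinct directions cannot fit in the complement of [S], which has two elements. *)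
    have : (#|[set a; b; c]%SET| <= #|~: S|)%N.
      apply: subset_leq_card; apply/fintype.subsetP => y.
      by rewrite !finset.in_setU !finset.in_set1 => /orP[/orP[]|] /eqP ->; exact: aS.
    have := cardsC S; rewrite cS card_ord => cC.
    rewrite finset.setUC cardsU1 cards2 !inE ab (eq_sym c a) (negPf ac).
    by rewrite (eq_sym c b) (negPf bc) /= -(leq_add2l 2) cC.
  - by rewrite !size_tuple.
  - by rewrite /= sj; apply: hs; rewrite /= mem_head.
  - by rewrite nj; move: us => /= /andP[]; rewrite inE negb_or => /andP[].
  - by rewrite nj; move: us' => /= /andP[]; rewrite inE negb_or => /andP[].
  - by move: us => /andP[].
  - by move: us' => /andP[].
  - by move=> e es; apply: hs; rewrite /= inE es orbT.
  - by move=> e es; apply: hs'; rewrite /= inE es orbT.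
by apply: probability_le1; apply: fin_bigcup_measurable => //; exact: finite_finset.
Qed.

(** A union bound over walks. Independence gives each one the factor [(1 - eps) ^+ m.+1], its edges
    being distinct; what remains sums to at most 1 for each of the four first steps. *)
Lemma probability_exists_closed_walk v m : eps <= 1 ->
  (P (exists_closed_walk v m) <= (4 * (1 - eps) ^+ m.+1)%:E)%E.
Proof.
move=> eps1.
have q0 : 0 <= (1 - eps) ^+ m.+1 by rewrite exprn_ge0 // subr_ge0.
have step : (P (exists_closed_walk v m) <=
    \sum_(a : 'I_4 * m.-tuple 'I_4) P (closed_walk v (a.1 :: a.2)))%E.
  rewrite /exists_closed_walk.
  rewrite (fsbig_seq _ _ (index_enum_uniq _)).
  have -> : [set` index_enum ('I_4 * m.-tuple 'I_4)%type] = setT.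
    by apply/seteqP; split => i //= _; exact: mem_index_enum.
  apply: content_sub_fsum => //; first exact: finite_finset.
  - by move=> s _; exact: measurable_closed_walk.
  - exact: measurable_exists_closed_walk.
apply: (le_trans step); rewrite -(pair_bigA _ (fun i s => P (closed_walk v (i :: tval s)))) /=.
apply: (@le_trans _ _ (\sum_(i < 4) ((1 - eps) ^+ m.+1)%:E)%E); last first.
  by rewrite sumEFin sumr_const card_ord mulr_natl.
apply: lee_sum => i _.
have -> : (\sum_(s : m.-tuple 'I_4) P (closed_walk v (i :: s)) =
  ((1 - eps) ^+ m.+1)%:E * \sum_(s : m.-tuple 'I_4 | uniq (v :: walk v (i :: s)))
    P (unreinforced (walk_edges v (i :: s))))%E.
  rewrite ge0_sume_distrr // [RHS]big_mkcond; apply: eq_bigr => s _.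
  rewrite /closed_walk; case: ifP => us; last by rewrite measure0.
  rewrite spr_indep; [|exact: generated_unreinforced|exact: generated_unsprinkled].
  rewrite probability_unsprinkled ?uniq_walk_edges // size_walk_edges /= size_tuple.
  by rewrite muleC.
rewrite -[leRHS]mule1; apply: lee_wpmul2l; first by rewrite lee_fin.
exact: sum_unreinforced_walks.
Qed.

End LongWalks.

(** * Borel-Cantelli and the conclusion *)

Lemma sum_geometric_lt_pinfty (R : realType) (q : R) (c : R) : 0 <= q < 1 -> 0 <= c ->
  (\sum_(m <oo) (c * q ^+ m.+1)%:E < +oo)%E.
Proof.
move=> /andP[q0 q1] c0; apply: (@le_lt_trans _ _ (c / (1 - q))%:E); last exact: ltry.
apply: lime_le.
  by apply: is_cvg_nneseries => m _ _; rewrite lee_fin mulr_ge0 ?exprn_ge0.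
apply: nearW => n; rewrite sumEFin lee_fin -mulr_sumr ler_wpM2l// big_mkord.
have geomE : (1 - q) * \sum_(i < n) q ^+ i = 1 - q ^+ n.
  by rewrite -opprB mulNr -subrX1 opprB.
under eq_bigr do rewrite exprS.
rewrite -[leRHS]div1r ler_pdivlMr ?subr_gt0 // -mulr_sumr -mulrA.
by rewrite [_ * (1 - q)]mulrC geomE; have := exprn_ge0 n q0; nra.
Qed.

Theorem theorem3 (R : realType) (d : measure_display) (T : measurableType d)
    (P : probability T R) (eps : R)
    (sigma : nat -> site -> T -> 'S_4) (spr : edge -> T -> bool)
    (eps_gt0 : 0 < eps) (eps_le1 : eps <= 1)
    (sigma_unif : uniform_tie_breaking P sigma)
    (spr_bern : bernoulli_percolation P eps spr)
    (spr_indep : independent_families P (weight_process 2 sigma) spr) :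
  P [set x | percolates
       (reinforced_edges R 2 sigma x `|` sprinkled_edges spr x)] = 1%E \/
  P [set x | percolates_dually
       (reinforced_edges R 2 sigma x `|` sprinkled_edges spr x)] = 1%E.
Proof.
right; set E := [set x | _].
have mE : measurable E.
  apply: measurable_percolates_dually => e; apply: measurableU.
    exact: (measurable_reinforced_edges sigma_unif).
  have [mspr _ _] := spr_bern; exact: mspr e true.
pose v m : site := (m.+1%:Z, 0).
pose F m := exists_closed_walk R sigma spr (v m) m.
have mF m : measurable (F m) by exact: (measurable_exists_closed_walk sigma_unif spr_bern).
have limF : P (lim_sup_set F) = 0%E.
  apply: lim_sup_set_cvg0 => //.
  apply: le_lt_trans (sum_geometric_lt_pinfty (q := 1 - eps) (c := 4) _ _); last 2 first.
  - by apply/andP; split; lra.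
  - by [].
  apply: lee_nneseries => // m _.
  exact: (probability_exists_closed_walk sigma_unif spr_bern).
(* Without dual percolation [exists_long_walk] yields arbitrarily large [m] for which [F m] occurs;
   its [m.+1] directions split into the first one and an [m]-tuple. *)
have subE : ~` E `<=` lim_sup_set F.
  move=> x /= noperc n _; have [m [s [nm ss us cs]]] := exists_long_walk noperc n.
  exists m => //; case: s ss us cs => // i s [ss] us cs.
  have ss' : size s == m by apply/eqP.
  exists (i, Tuple ss') => //=; rewrite /closed_walk us; split => e /= /cs h.
    by move=> he; apply: h; left.
  by apply/negbTE/negP => he; apply: h; right.
have PE : P (~` E) = 0%E.
  apply/eqP; rewrite eq_le measure_ge0 andbT -limF; apply: le_measure => //.
    by rewrite inE; exact: measurableC.
  rewrite inE; apply: bigcapT_measurable => n; exact: bigcup_measurable.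
have := probability_setC P (measurableC mE); rewrite setCK => ->.
by rewrite PE sube0.
Qed.
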